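(* Let $F=(F_1,\dots,F_m):\mathbb{R}^n\to\mathbb{R}^m$ be continuously differentiable, let $x^0\in\mathbb{R}^n$, and assume that the set $\Omega=\{x\in\mathbb{R}^n: F(x)\leq F(x^0)\}$ (componentwise inequality) is bounded. Let $\{x^k\}_{k\ge 0}$ be an infinite sequence of points that are not Pareto critical, generated from $x^0$ by the Barzilai-Borwein descent method (BBDMO), where the line search used is any one of the Armijo (monotone), max-type nonmonotone, or average-type nonmonotone line searches. Then every accumulation point of $\{x^k\}$ is a Pareto critical point of $F$.
   Context: Notation: $[m]=\{1,\dots,m\}$; $\Delta_m=\{\lambda\in\mathbb{R}^m:\sum_{i\in[m]}\lambda_i=1,\ \lambda_i\ge 0\}$; $JF(x)\in\mathbb{R}^{m\times n}$ is the Jacobian; $\mathbb{R}_{++}^m$ is the set of vectors with strictly positive entries; inequalities between vectors are componentwise; $\|\cdot\|$ is the Euclidean norm. Pareto critical: $x^*$ is Pareto critical if $\mathrm{range}(JF(x^* ))\cap(-\mathbb{R}_{++}^m)=\emptyset$, i.e. there is no $d\in\mathbb{R}^n$ with $\langle\nabla F_i(x^* ),d\rangle<0$ for all $i\in[m]$. Line searches. Fix $\sigma,\gamma\in(0,1)$. Given $x^k$, a direction $d^k$ and a reference vector $C^k\in\mathbb{R}^m$, the stepsize $\beta^k$ is the largest element $\beta$ of $\{1,\gamma,\gamma^2,\dots\}$ such that $$F(x^k+\beta d^k)-C^k\le \sigma\beta\, JF(x^k)d^k .$$ - Armijo (monotone): $C^k=F(x^k)$. - Max-type nonmonotone: $C^k_i=\max_{0\le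 j\le\min(k,M)}F_i(x^{k-j})$ for $i\in[m]$, with a fixed nonnegative integer $M$. - Average-type nonmonotone: with fixed $\eta\in(0,1)$, $q^0=1$, $C^0=F(x^0)$, and for $k\ge1$: $q^k=\eta q^{k-1}+1$, $C^k=\frac{\eta q^{k-1}}{q^k}C^{k-1}+\frac{1}{q^k}F(x^k)$. BBDMO. Fix constants $0<\alpha_{\min}\leq\alpha_{\max}$. - For $k=0$: let $d^0=-\sum_{i\in[m]}\lambda_i^0\nabla F_i(x^0)$, where $\lambda^0\in\arg\min_{\lambda\in\Delta_m}\frac12\|\sum_i\lambda_i\nabla F_i(x^0)\|^2$, let $\beta^0$ be the Armijo stepsize along $d^0$, and set $x^1=x^0+\beta^0d^0$. - For $k\ge1$: put $s^{k-1}=x^k-x^{k-1}$, $y_i^{k-1}=\nabla F_i(x^k)-\nabla F_i(x^{k-1})$, and for each $i\in[m]$ $$\alpha_i^k=\begin{cases}\max\left\{\alpha_{\min},\min\left\{\frac{\langle s^{k-1},y_i^{k-1}\rangle}{\langle s^{k-1},s^{k-1}\rangle},\alpha_{\max}\right\}\right\}, & \langle s^{k-1},y_i^{k-1}\rangle>0,\\[4pt] \max\left\{\alpha_{\min},\min\left\{\frac{\|y_i^{k-1}\|}{\|s^{k-1}\|},\alpha_{\max}\right\}\right\}, & \langle s^{k-1},y_i^{k-1}\rangle<0,\\[4pt] \alpha_{\min}, & \langle s^{k-1},y_i^{k-1}\rangle=0.\end{cases}$$ Let $\lambda^k\in\arg\min_{\lambda\in\Delta_m}\frac12\left\|\sum_{i\in[m]}\lambda_i\frac{1}{\alpha_i^k}\nabla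 F_i(x^k)\right\|^2$ and $d^k_{BB}=-\sum_{i\in[m]}\lambda_i^k\frac{1}{\alpha_i^k}\nabla F_i(x^k)$ (equivalently, $d^k_{BB}$ is the unique minimizer over $d\in\mathbb{R}^n$ of $\max_{i\in[m]}\langle\frac{1}{\alpha_i^k}\nabla F_i(x^k),d\rangle+\frac12\|d\|^2$). If $d^k_{BB}=0$ the method stops at the Pareto critical point $x^k$; otherwise $\beta^k$ is the stepsize given by the chosen line search along $d^k_{BB}$ and $x^{k+1}=x^k+\beta^kd^k_{BB}$. *)

(* Defs.v *)
From HB Require Import structures.
From mathcomp Require Import all_boot all_order all_algebra.
From mathcomp Require Import all_classical all_reals all_analysis.
Set Implicit Arguments.
Unset Strict Implicit.
Unset Printing Implicit Defensive.
Import Order.TTheory GRing.Theory Num.Theory.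
Import numFieldNormedType.Exports.
Local Open Scope classical_set_scope.
Local Open Scope ring_scope.

(* Points of R^n and values in R^m are row vectors.  The library norm on       *)
(* 'rV[R]_n is the sup norm (it fixes the usual topology and bounded sets);    *)
(* the Euclidean norm of the algorithm is [enorm].                             *)
Definition dotr (R : realType) (n : nat) (u v : 'rV[R]_n) : R :=
  \sum_(j < n) u 0 j * v 0 j.

Definition enorm (R : realType) (n : nat) (u : 'rV[R]_n) : R :=
  Num.sqrt (dotr u u).

Definition vle (R : realType) (m : nat) (u v : 'rV[R]_m) : Prop :=
  forall i, u 0 i <= v 0 i.

Definition continuously_differentiable (R : realType) (n m : nat)
    (F : 'rV[R]_n -> 'rV[R]_m) : Prop :=
  (forall x, differentiable F x) /\ continuous (jacobian F).

(* [jacobian F x] acts on row vectors from the right, i.e. it is the n x m     *)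
(* transpose of JF(x): JF(x)d is [d *m jacobian F x], and the gradient of F_i  *)
(* is its i-th column.                                                         *)
Definition Japply (R : realType) (n m : nat) (F : 'rV[R]_n -> 'rV[R]_m)
    (x d : 'rV[R]_n) : 'rV[R]_m :=
  d *m jacobian F x.

Definition grad (R : realType) (n m : nat) (F : 'rV[R]_n -> 'rV[R]_m)
    (i : 'I_m) (x : 'rV[R]_n) : 'rV[R]_n :=
  (col i (jacobian F x))^T.

Definition pareto_critical (R : realType) (n m : nat)
    (F : 'rV[R]_n -> 'rV[R]_m) (x : 'rV[R]_n) : Prop :=
  range (Japply F x) `&` [set v : 'rV[R]_m | forall i, v 0 i < 0] = set0.

Definition simplex (R : realType) (m : nat) : set 'rV[R]_m :=
  [set lam | \sum_(i < m) lam 0 i = 1 /\ forall i, 0 <= lam 0 i].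
Arguments simplex R m : clear implicits.

Definition lincomb (R : realType) (n m : nat) (g : 'I_m -> 'rV[R]_n)
    (lam : 'rV[R]_m) : 'rV[R]_n :=
  \sum_(i < m) lam 0 i *: g i.

Definition argmin_simplex (R : realType) (n m : nat) (g : 'I_m -> 'rV[R]_n)
  : set 'rV[R]_m :=
  [set lam | simplex R m lam /\
    forall mu, simplex R m mu ->
      2^-1 * enorm (lincomb g lam) ^+ 2 <= 2^-1 * enorm (lincomb g mu) ^+ 2].

Definition sufficient_decrease (R : realType) (n m : nat)
    (F : 'rV[R]_n -> 'rV[R]_m) (sigma : R) (x d : 'rV[R]_n) (C : 'rV[R]_m)
    (beta : R) : Prop :=
  vle (F (x + beta *: d) - C) ((sigma * beta) *: Japply F x d).

Definition is_stepsize (R : realType) (n m : nat) (F : 'rV[R]_n -> 'rV[R]_m)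
    (sigma gamma : R) (x d : 'rV[R]_n) (C : 'rV[R]_m) (beta : R) : Prop :=
  let trial := [set b | (exists l : nat, b = gamma ^+ l) /\
                        sufficient_decrease F sigma x d C b] in
  trial beta /\ forall b, trial b -> b <= beta.

Definition armijo_ref (R : realType) (n m : nat) (F : 'rV[R]_n -> 'rV[R]_m)
    (x : nat -> 'rV[R]_n) (k : nat) : 'rV[R]_m :=
  F (x k).

(* The default [F (x k) 0 i] of the iterated maximum is its j = 0 term.        *)
Definition max_ref (R : realType) (n m : nat) (M : nat)
    (F : 'rV[R]_n -> 'rV[R]_m) (x : nat -> 'rV[R]_n) (k : nat) : 'rV[R]_m :=
  \row_(i < m)
    \big[Order.max/F (x k) 0 i]_(j < (minn k M).+1) F (x (k - j)%N) 0 i.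

Fixpoint avg_weight (R : realType) (eta : R) (k : nat) : R :=
  if k is k'.+1 then eta * avg_weight eta k' + 1 else 1.

Fixpoint avg_ref (R : realType) (n m : nat) (eta : R)
    (F : 'rV[R]_n -> 'rV[R]_m) (x : nat -> 'rV[R]_n) (k : nat) : 'rV[R]_m :=
  if k is k'.+1 then
    (eta * avg_weight eta k' / avg_weight eta k) *: avg_ref eta F x k'
    + (avg_weight eta k)^-1 *: F (x k)
  else F (x 0%N).

Definition line_search_ref (R : realType) (n m : nat)
    (F : 'rV[R]_n -> 'rV[R]_m) (x : nat -> 'rV[R]_n) (C : nat -> 'rV[R]_m)
  : Prop :=
  [\/ C = armijo_ref F x,
      exists M : nat, C = max_ref M F x
    | exists eta : R, 0 < eta < 1 /\ C = avg_ref eta F x].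

Definition bb_alpha (R : realType) (n : nat) (amin amax : R)
    (s y : 'rV[R]_n) : R :=
  if 0 < dotr s y then
    Num.max amin (Num.min (dotr s y / dotr s s) amax)
  else if dotr s y < 0 then
    Num.max amin (Num.min (enorm y / enorm s) amax)
  else amin.

(* [scaled_grad _ _ _ x k] is the family (1/alpha_i^k) grad F_i(x^k); it is    *)
(* only meant for k >= 1.                                                      *)
Definition scaled_grad (R : realType) (n m : nat) (F : 'rV[R]_n -> 'rV[R]_m)
    (amin amax : R) (x : nat -> 'rV[R]_n) (k : nat) (i : 'I_m) : 'rV[R]_n :=
  let s := x k - x k.-1 in
  let y := grad F i (x k) - grad F i (x k.-1) in
  (bb_alpha amin amax s y)^-1 *: grad F i (x k).

(* An infinite run: the stopping test fails at every k >= 1, and the first     *)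
(* iteration uses the unscaled gradients and the Armijo rule whatever C is.    *)
Definition bbdmo_run (R : realType) (n m : nat) (F : 'rV[R]_n -> 'rV[R]_m)
    (sigma gamma amin amax : R) (C : nat -> 'rV[R]_m) (x : nat -> 'rV[R]_n)
  : Prop :=
  exists (lam : nat -> 'rV[R]_m) (d : nat -> 'rV[R]_n) (beta : nat -> R),
  [/\ argmin_simplex (fun i => grad F i (x 0%N)) (lam 0%N),
      d 0%N = - lincomb (fun i => grad F i (x 0%N)) (lam 0%N),
      is_stepsize F sigma gamma (x 0%N) (d 0%N) (F (x 0%N)) (beta 0%N),
      forall k : nat, (0 < k)%N ->
        [/\ argmin_simplex (scaled_grad F amin amax x k) (lam k),
            d k = - lincomb (scaled_grad F amin amax x k) (lam k),
            d k != 0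
          & is_stepsize F sigma gamma (x k) (d k) (C k) (beta k)]
    & forall k : nat, x k.+1 = x k + beta k *: d k].

(* Main.v *)
Require Import Defs.
From HB Require Import structures.
From mathcomp Require Import all_boot all_order all_algebra.
From mathcomp Require Import all_classical all_reals all_analysis.
From mathcomp Require Import zify ring lra.
Import Order.TTheory GRing.Theory Num.Theory.
Import numFieldNormedType.Exports.
Local Open Scope classical_set_scope.
Local Open Scope ring_scope.

(* Put delta_k = beta_k |d_k|^2.  Optimality of lambda^k gives
   <d_k, grad F_i(x_k)> <= - c |d_k|^2 with c = min(1, amin), so the line search
   yields F_i(x_{k+1}) <= C_i^k - sigma c delta_k.  The reference values are
   nonincreasing and bounded below, and this forces delta_k -> 0 for each of the
   line searches (the Armijo rule being the max-type rule with M = 0).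
   If p is not critical, some v has <grad F_i, v> <= - e near p for all i, so
   |d_k|^2 is bounded below by a positive constant when x_k is near p.  For large
   such k this forces beta_k < 1, so the trial beta_k / gamma was rejected; as
   |(beta_k / gamma) d_k| is small, the mean value theorem then makes the
   gradient of some F_i vary by a fixed amount within a small ball around p,
   contradicting its continuity. *)

Set Implicit Arguments.
Unset Strict Implicit.
Unset Printing Implicit Defensive.

(** * Real sequences: monotone limits and window maxima *)

Lemma nonincreasing_limn (R : realType) (u : nat -> R) (b : R) :
  (forall k, u k.+1 <= u k) -> (forall k, b <= u k) ->
  exists2 l : R, (forall k, l <= u k) &
    forall e, 0 < e -> \forall k \near \oo, u k < l + e.
Proof.
move=> /nonincreasing_seqP udec ub.
have uc : cvgn u.
  by apply: nonincreasing_is_cvgn => //; exists b => _ [k _ <-].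
exists (limn u); first exact: nonincreasing_cvgn_ge.
move=> e e0; apply: (cvgr_lt (limn u)); first exact: uc.
by rewrite ltrDl.
Qed.

(** One component of [max_ref], detached from [F] so that the convergence argument concerns real
    sequences only. *)
Definition window_max (R : realType) (M : nat) (f : nat -> R) (k : nat) : R :=
  \big[Order.max/f k]_(j < (minn k M).+1) f (k - j)%N.

Lemma window_max_ge (R : realType) (M : nat) (f : nat -> R) (k j : nat) :
  (j <= k)%N -> (j <= M)%N -> f (k - j)%N <= window_max M f k.
Proof.
move=> jk jM.
have jlt : (j < (minn k M).+1)%N by lia.
exact: (le_bigmax _ _ (Ordinal jlt)).
Qed.

Lemma window_max_le (R : realType) (M : nat) (f : nat -> R) (k : nat) (a : R) :
  (forall j, (j <= k)%N -> (j <= M)%N -> f (k - j)%N <= a) ->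
  window_max M f k <= a.
Proof.
move=> fa; apply: bigmax_le; first by rewrite -[k in f k]subn0; apply: fa.
by move=> [j jlt] _ /=; apply: fa; lia.
Qed.

Lemma window_max_attained (R : realType) (M : nat) (f : nat -> R) (k : nat)
    (a : R) : a <= window_max M f k ->
  exists j, [/\ (j <= k)%N, (j <= M)%N & a <= f (k - j)%N].
Proof.
move=> /bigmax_geP[afk|[[j jlt] _ /= afj]].
  by exists 0%N; rewrite subn0; split.
by exists j; split=> //; lia.
Qed.

Lemma window_max_cur (R : realType) (M : nat) (f : nat -> R) (k : nat) :
  f k <= window_max M f k.
Proof. by rewrite -[k in f k]subn0 window_max_ge. Qed.

(** The window at [k.+1] consists of the new value and of entries already in the window at [k]. *)
Lemma window_max_noninc (R : realType) (M : nat) (f : nat -> R) (k : nat) :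
  f k.+1 <= window_max M f k -> window_max M f k.+1 <= window_max M f k.
Proof.
move=> fk; apply: window_max_le => -[|j] jk jM; first by rewrite subn0.
by rewrite subSS; apply: window_max_ge; lia.
Qed.

(* The Grippo-Lampariello-Lucidi argument: the window maxima converge to some
   l; any k with f k.+1 close to l has a small step, so f k is close to l as
   well, and by downward propagation all steps of a window are small as soon as
   its maximum, which is at least l, has been reached. *)
Lemma window_max_step_to0 (R : realType) (M : nat) (f delta : nat -> R)
    (b c K : R) : 0 < c -> 0 <= K ->
  (forall k, b <= f k) ->
  (forall k, 0 <= delta k) ->
  (forall k, f k.+1 <= window_max M f k - c * delta k) ->
  (forall k, (f k.+1 - f k) ^+ 2 <= K * delta k) ->
  forall e, 0 < e -> \forall k \near \oo, delta k < e.
Proof.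
move=> c0 K0 fb d0 fdec fvar.
have Wdec k : window_max M f k.+1 <= window_max M f k.
  by apply/window_max_noninc/(le_trans (fdec k)); rewrite gerBl mulr_ge0 // ltW.
have [l lW Wl] := nonincreasing_limn Wdec
  (fun k => le_trans (fb k) (window_max_cur M f k)).
have step e : 0 < e ->
    \forall k \near \oo, l - e < f k.+1 -> c * delta k < 2 * e.
  move=> e0; near=> k => lf.
  have Wk : window_max M f k < l + e by near: k; exact: Wl.
  by have := fdec k; lra.
have back e : 0 < e -> exists2 e', 0 < e' &
    \forall k \near \oo, l - e' < f k.+1 -> l - e < f k.
  move=> e0.
  have K1 : 0 < K + 1 by lra.
  (* Chosen so that [c * delta k < 2 * e1] gives [K * delta k <= (e / 2) ^+ 2]: [f] varies by at
     most [e / 2], and the other half of [e] comes from [f k.+1]. Using [K + 1] keeps the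
     denominator positive when [K = 0]. *)
  pose e1 := c * (e / 2) ^+ 2 / (2 * (K + 1)).
  have e10 : 0 < e1.
    by rewrite /e1 divr_gt0 ?mulr_gt0 ?exprn_gt0 ?divr_gt0 //; lra.
  exists (Num.min (e / 2) e1); first by rewrite lt_min e10 divr_gt0.
  have m0 : 0 < Num.min (e / 2) e1 by rewrite lt_min e10 divr_gt0.
  near=> k => lf.
  have cd : c * delta k < 2 * Num.min (e / 2) e1.
    by move: lf; near: k; exact: step.
  have me1 : Num.min (e / 2) e1 <= e1 by rewrite ge_min lexx orbT.
  have me2 : Num.min (e / 2) e1 <= e / 2 by rewrite ge_min lexx.
  have e1E : 2 * e1 * (K + 1) = c * (e / 2) ^+ 2.
    by rewrite /e1; field; rewrite gt_eqF.
  have sq : (f k.+1 - f k) ^+ 2 <= (e / 2) ^+ 2.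
    rewrite -(ler_pM2l c0) -e1E.
    apply: (@le_trans _ _ (K * (c * delta k))).
      by rewrite [leRHS]mulrCA ler_pM2l.
    by have := d0 k; nra.
  have : f k.+1 - f k <= e / 2 by nra.
  by lra.
have backn j e : 0 < e -> exists2 e', 0 < e' &
    \forall k \near \oo, l - e' < f (k + j)%N -> l - e < f k.
  elim: j e => [|j IH] e e0; first by exists e => //; near=> k; rewrite addn0.
  have [e1 e10 [N1 _ H1]] := back _ e0.
  have [e2 e20 [N2 _ H2]] := IH _ e10.
  exists e2 => //; exists (N1 + N2)%N => // k /= Nk lf.
  apply: H1 => /=; first lia.
  apply: H2 => /=; first lia.
  by rewrite addSnnS.
move=> e e0.
have ce0 : 0 < c * e / 2 by rewrite divr_gt0 ?mulr_gt0.
have win : \forall k \near \oo, forall j : 'I_M.+1,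
    l <= f (k.+1 + j)%N -> delta k < e.
  apply: filter_forall => j.
  have [e1 e10 [N1 _ H1]] := backn j _ ce0.
  have [N2 _ H2] := step _ ce0.
  exists (N1 + N2)%N => // k /= Nk lf.
  rewrite -(ltr_pM2l c0); have -> : c * e = 2 * (c * e / 2) by field.
  apply: H2 => /=; first lia.
  by apply: H1 => /=; [lia|lra].
near=> k.
(* The window ending at [k + M.+1] lies within the indices from [k.+1] to [k + M.+1], so a value at
   least [l] occurs at most [M] places after [k.+1]. *)
have [j [jk jM lf]] := window_max_attained (lW (k + M.+1)%N).
have jlt : (M - j < M.+1)%N by lia.
suff wk : forall j : 'I_M.+1, l <= f (k.+1 + j)%N -> delta k < e.
  apply: (wk (Ordinal jlt)) => /=.
  by have -> : (k.+1 + (M - j) = k + M.+1 - j)%N by lia.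
by near: k.
Unshelve. all: by end_near. Qed.

(** * Real sequences: running averages *)

Lemma avg_weight_ge1 (R : realType) (eta : R) (k : nat) :
  0 < eta -> 1 <= avg_weight eta k.
Proof. by move=> e0; elim: k => //= k IH; nra. Qed.

(** The weights are partial sums of the geometric series of [eta]; hence a new value always enters
    the average with weight at least [1 - eta]. *)
Lemma avg_weight_le (R : realType) (eta : R) (k : nat) :
  0 < eta < 1 -> (1 - eta) * avg_weight eta k <= 1.
Proof. by move=> /andP[e0 e1]; elim: k => [|k IH] /=; nra. Qed.

Fixpoint running_avg (R : realType) (eta : R) (f : nat -> R) (k : nat) : R :=
  if k is k'.+1 then
    eta * avg_weight eta k' / avg_weight eta k * running_avg eta f k'
    + (avg_weight eta k)^-1 * f k
  else f 0%N.

(** The two coefficients of the average sum to 1, so the average moves towards the new value by the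
    fraction [1 / avg_weight eta k.+1] of the gap. *)
Lemma running_avgS (R : realType) (eta : R) (f : nat -> R) (k : nat) :
  0 < eta ->
  running_avg eta f k - running_avg eta f k.+1
  = (running_avg eta f k - f k.+1) / avg_weight eta k.+1.
Proof.
move=> e0 /=; have := @avg_weight_ge1 _ eta k e0.
set q := avg_weight eta k => q1.
have q0 : eta * q + 1 != 0 by rewrite gt_eqF //; nra.
by field.
Qed.

Lemma running_avg_noninc (R : realType) (eta : R) (f : nat -> R) (k : nat) :
  0 < eta -> f k.+1 <= running_avg eta f k ->
  running_avg eta f k.+1 <= running_avg eta f k.
Proof.
move=> e0 fk; rewrite -subr_ge0 running_avgS // divr_ge0 ?subr_ge0 //.
exact: le_trans (avg_weight_ge1 _ _).
Qed.

(** That fraction is at most 1, so the average cannot drop below the new value. *)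
Lemma running_avg_cur (R : realType) (eta : R) (f : nat -> R) :
  0 < eta -> (forall k, f k.+1 <= running_avg eta f k) ->
  forall k, f k <= running_avg eta f k.
Proof.
move=> e0 fdec [|k] //.
have q1 := @avg_weight_ge1 _ eta k.+1 e0.
have := running_avgS f k e0; have := fdec k.
set r := running_avg eta f k; set r' := running_avg eta f k.+1 => fr rE.
have : (r - f k.+1) / avg_weight eta k.+1 <= r - f k.+1.
  by rewrite ler_pdivrMr; nra.
by lra.
Qed.

(** Each step lowers the average by at least [c * (1 - eta) * delta k], while the average
    converges. *)
Lemma running_avg_step_to0 (R : realType) (eta : R) (f delta : nat -> R)
    (b c : R) : 0 < eta < 1 -> 0 < c ->
  (forall k, b <= f k) ->
  (forall k, 0 <= delta k) ->
  (forall k, f k.+1 <= running_avg eta f k - c * delta k) ->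
  forall e, 0 < e -> \forall k \near \oo, delta k < e.
Proof.
move=> eta01 c0 fb d0 fdec e e0.
have /andP[eta0 eta1] := eta01.
have fle k : f k.+1 <= running_avg eta f k.
  by apply: le_trans (fdec k) _; rewrite gerBl mulr_ge0 // ltW.
have [l lr rl] := nonincreasing_limn
  (fun k => running_avg_noninc eta0 (fle k))
  (fun k => le_trans (fb k) (running_avg_cur eta0 fle k)).
have h0 : 0 < c * (1 - eta) by rewrite mulr_gt0 ?subr_gt0.
near=> k.
have rk : running_avg eta f k < l + c * (1 - eta) * e.
  by near: k; apply: rl; rewrite mulr_gt0.
rewrite -(ltr_pM2l h0).
have q1 := @avg_weight_ge1 _ eta k.+1 eta0.
have q2 := @avg_weight_le _ eta k.+1 eta01.
have q0 : 0 < avg_weight eta k.+1 by lra.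
have : c * (1 - eta) * delta k <=
    (running_avg eta f k - f k.+1) / avg_weight eta k.+1.
  rewrite ler_pdivlMr //.
  apply: (@le_trans _ _ (c * delta k)); last by have := fdec k; lra.
  have cd : 0 <= c * delta k by rewrite mulr_ge0 // ltW.
  by nra.
rewrite -running_avgS //; have := lr k.+1; lra.
Unshelve. all: by end_near. Qed.

(** * Euclidean inner product *)

Lemma dotrC (R : realType) (n : nat) (u v : 'rV[R]_n) : dotr u v = dotr v u.
Proof. by apply: eq_bigr => j _; rewrite mulrC. Qed.

Lemma dotrDl (R : realType) (n : nat) (u v w : 'rV[R]_n) :
  dotr (u + v) w = dotr u w + dotr v w.
Proof. by rewrite -big_split; apply: eq_bigr => j _; rewrite mxE mulrDl. Qed.

Lemma dotrZl (R : realType) (n : nat) (a : R) (u w : 'rV[R]_n) :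
  dotr (a *: u) w = a * dotr u w.
Proof. by rewrite mulr_sumr; apply: eq_bigr => j _; rewrite mxE mulrA. Qed.

Lemma dotrDr (R : realType) (n : nat) (u v w : 'rV[R]_n) :
  dotr w (u + v) = dotr w u + dotr w v.
Proof. by rewrite !(dotrC w) dotrDl. Qed.

Lemma dotrZr (R : realType) (n : nat) (a : R) (u w : 'rV[R]_n) :
  dotr w (a *: u) = a * dotr w u.
Proof. by rewrite !(dotrC w) dotrZl. Qed.

Lemma dotrNl (R : realType) (n : nat) (u w : 'rV[R]_n) :
  dotr (- u) w = - dotr u w.
Proof. by rewrite -scaleN1r dotrZl mulN1r. Qed.

Lemma dotrNr (R : realType) (n : nat) (u w : 'rV[R]_n) :
  dotr w (- u) = - dotr w u.
Proof. by rewrite !(dotrC w) dotrNl. Qed.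

Lemma dotr_ge0 (R : realType) (n : nat) (u : 'rV[R]_n) : 0 <= dotr u u.
Proof. by apply: sumr_ge0 => j _; rewrite -expr2 sqr_ge0. Qed.

Lemma dotr_suml (R : realType) (n : nat) (I : finType) (g : I -> 'rV[R]_n)
    (w : 'rV[R]_n) : dotr (\sum_i g i) w = \sum_i dotr (g i) w.
Proof.
rewrite exchange_big /=; apply: eq_bigr => j _.
by rewrite summxE mulr_suml.
Qed.

Definition dotrE := (dotrDl, dotrDr, dotrNl, dotrNr, dotrZl, dotrZr).

Lemma dotr_cauchy_schwarz (R : realType) (n : nat) (u v : 'rV[R]_n) :
  dotr u v ^+ 2 <= dotr u u * dotr v v.
Proof.
have P t : 0 <= dotr u u - 2 * t * dotr u v + t ^+ 2 * dotr v v.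
  apply: le_trans (dotr_ge0 (u - t *: v)) _.
  by rewrite !dotrE (dotrC v u); lra.
have v0 := dotr_ge0 v.
have [vv|vn0] := eqVneq (dotr v v) 0; last first.
  have vp : 0 < dotr v v by rewrite lt_def vn0.
  have := P (dotr u v / dotr v v); rewrite -(pmulr_lge0 _ vp).
  suff -> : (dotr u u - 2 * (dotr u v / dotr v v) * dotr u v +
     (dotr u v / dotr v v) ^+ 2 * dotr v v) * dotr v v
     = dotr u u * dotr v v - dotr u v ^+ 2 by rewrite subr_ge0.
  by field.
rewrite vv mulr0; move: P; rewrite vv => P.
have [->|uv] := eqVneq (dotr u v) 0; first by rewrite expr0n.
(* With [dotr v v = 0] the expression in [P] is affine in [t]; this [t] makes it equal to -1. *)
have := P ((dotr u u + 1) / (2 * dotr u v)).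
suff -> : 2 * ((dotr u u + 1) / (2 * dotr u v)) * dotr u v = dotr u u + 1.
  by lra.
by field.
Qed.

(** Parallelogram law for [u - w] and [v - w], dropping the square of their sum. *)
Lemma dotr_sub_le (R : realType) (n : nat) (u v w : 'rV[R]_n) :
  dotr (u - v) (u - v) <= 2 * dotr (u - w) (u - w) + 2 * dotr (v - w) (v - w).
Proof.
have := dotr_ge0 ((u - w) + (v - w)).
by rewrite !dotrE (dotrC w u) (dotrC v u) (dotrC w v); lra.
Qed.

Lemma dotr_ge_sq_entry (R : realType) (n : nat) (u : 'rV[R]_n) (j : 'I_n) :
  u 0 j ^+ 2 <= dotr u u.
Proof.
rewrite /dotr (bigD1 j) //= expr2 lerDl.
by apply: sumr_ge0 => i _; rewrite -expr2 sqr_ge0.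
Qed.

(** The sup norm is dominated by the Euclidean norm; this turns Euclidean estimates into membership
    in topological balls. *)
Lemma norm_lt_of_dotr (R : realType) (n : nat) (u : 'rV[R]_n) (e : R) :
  0 < e -> dotr u u < e ^+ 2 -> `|u| < e.
Proof.
move=> e0 ue; rewrite /Num.Def.normr /= mx_normrE.
apply/bigmax_ltP; split=> // -[i j] _ /=; rewrite ord1.
have := le_lt_trans (dotr_ge_sq_entry u j) ue.
by rewrite ltr_norml => h; apply/andP; split; nra.
Qed.

(** * Minimum-norm points over the simplex and Barzilai-Borwein scalings *)

Lemma enorm_sq (R : realType) (n : nat) (u : 'rV[R]_n) :
  enorm u ^+ 2 = dotr u u.
Proof. by rewrite sqr_sqrtr ?dotr_ge0. Qed.

(* Moving lam towards the i-th vertex of the simplex cannot decrease the norm. *)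
Lemma argmin_simplex_dotr (R : realType) (n m : nat) (g : 'I_m -> 'rV[R]_n)
    (lam : 'rV[R]_m) (i : 'I_m) : argmin_simplex g lam ->
  dotr (lincomb g lam) (lincomb g lam) <= dotr (g i) (lincomb g lam).
Proof.
move=> [[lam1 lam0] lammin]; set w := lincomb g lam.
have P t : 0 < t -> t <= 1 ->
    0 <= 2 * dotr w (g i - w) + t * dotr (g i - w) (g i - w).
  move=> t0 t1.
  have muS : simplex R m ((1 - t) *: lam + t *: delta_mx 0 i).
    split=> [|j].
      under eq_bigr do rewrite !mxE.
      rewrite big_split /= -!mulr_sumr lam1 (bigD1 i) //= !eqxx big1 => [|j].
        by rewrite mulr1n; lra.
      by move=> /negbTE ->.
    rewrite !mxE addr_ge0 // mulr_ge0 ?subr_ge0 // ?lam0 // ?ler0n //.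
    exact: ltW.
  have lmu : lincomb g ((1 - t) *: lam + t *: delta_mx 0 i)
      = w + t *: (g i - w).
    rewrite /lincomb.
    under eq_bigr do rewrite !mxE scalerDl -!scalerA.
    rewrite big_split /= -!scaler_sumr -/(lincomb g lam) -/w.
    rewrite (bigD1 i) //= !eqxx big1 => [|j /negbTE ->]; last first.
      by rewrite /= scale0r.
    by rewrite scale1r addr0 scalerBl scale1r scalerBr addrAC addrA.
  have := lammin _ muS; rewrite !enorm_sq lmu -/w ler_pM2l ?invr_gt0 //.
  move: (g i - w) => v.
  rewrite !dotrE (dotrC v w) => h.
  by rewrite -(pmulr_rge0 _ t0); lra.
have B0 := dotr_ge0 (g i - w).
have : 0 <= dotr w (g i - w).
  rewrite leNgt; apply/negP => a0; move: P B0 a0.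
  set a := dotr w (g i - w); set B := dotr (g i - w) (g i - w) => P B0 a0.
  have D0 : 0 < B - a by lra.
  (* This [t] satisfies [t * B <= - a], so [2 * a + t * B <= a < 0], contradicting [P]. *)
  have t0 : 0 < - a / (B - a) by rewrite divr_gt0 // oppr_gt0.
  have t1 : - a / (B - a) <= 1 by rewrite ler_pdivrMr //; lra.
  have := P _ t0 t1.
  have tB : - a / (B - a) * B <= - a.
    by rewrite mulrAC ler_pdivrMr //; nra.
  by lra.
by rewrite !dotrE (dotrC w (g i)); lra.
Qed.

Lemma bb_alpha_ge (R : realType) (n : nat) (amin amax : R) (s y : 'rV[R]_n) :
  amin <= bb_alpha amin amax s y.
Proof.
rewrite /bb_alpha; case: ifP => _; last case: ifP => _ //.
  by rewrite le_max lexx.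
by rewrite le_max lexx.
Qed.

Lemma bb_alpha_le (R : realType) (n : nat) (amin amax : R) (s y : 'rV[R]_n) :
  amin <= amax -> bb_alpha amin amax s y <= amax.
Proof.
move=> a; rewrite /bb_alpha; case: ifP => _; last case: ifP => _ //.
  by rewrite ge_max a ge_min lexx orbT.
by rewrite ge_max a ge_min lexx orbT.
Qed.

(** * Continuity and compactness *)

Lemma continuous_sumr (R : realType) (T : topologicalType) (I : Type)
    (r : seq I) (f : I -> T -> R) :
  (forall i, continuous (f i)) -> continuous (fun z => \sum_(i <- r) f i z).
Proof.
move=> fc; elim: r => [|i r IH] z.
  have -> : (fun z => \sum_(i <- [::]) f i z) = cst 0.
    by apply/funext => y; rewrite big_nil.
  exact: cvg_cst.
have -> : (fun z => \sum_(i <- i :: r) f i z)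
    = (f i : T -> R) + (fun z => \sum_(i <- r) f i z).
  by apply/funext => y; rewrite big_cons.
by apply: cvgD; [exact: fc|exact: IH].
Qed.

Lemma continuous_dotr (R : realType) (T : topologicalType) (n : nat)
    (f g : T -> 'rV[R]_n) :
  (forall j, continuous (fun z => f z 0 j)) ->
  (forall j, continuous (fun z => g z 0 j)) ->
  continuous (fun z => dotr (f z) (g z)).
Proof.
by move=> fc gc; apply: continuous_sumr => j z; apply: cvgM; [exact: fc|exact: gc].
Qed.

Lemma compact_bounded_above (R : realType) (n : nat) (f : 'rV[R]_n -> R)
    (r : R) : continuous f ->
  exists2 b, 0 <= b & forall z : 'rV[R]_n, `|z| <= r -> f z <= b.
Proof.
move=> fc; have [r0|r0] := ltP r 0.
  by exists 0 => // z zr; have := le_lt_trans (normr_ge0 z) (le_lt_trans zr r0);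
    rewrite ltxx.
have [|||c _ fmax] := @EVT_max_rV R n f (closed_ball_ Num.norm 0 r).
- by exists 0; rewrite /closed_ball_ /= subrr normr0.
- apply: bounded_closed_compact; last exact: closed_closed_ball_.
  exists r; split; first exact: num_real.
  move=> M rM z; rewrite /closed_ball_ /= sub0r normrN => /le_trans; apply.
  exact: ltW.
- exact: continuous_subspaceT.
exists (Num.max 0 (f c)); first by rewrite le_max lexx.
move=> z zr; rewrite le_max fmax ?orbT // inE /closed_ball_ /=.
by rewrite sub0r normrN.
Qed.

(** * Gradients and the mean value theorem *)

Lemma Japply_dotr (R : realType) (n m : nat) (F : 'rV[R]_n -> 'rV[R]_m)
    (x d : 'rV[R]_n) (i : 'I_m) : Japply F x d 0 i = dotr d (grad F i x).
Proof. by rewrite mxE; apply: eq_bigr => j _; rewrite !mxE. Qed.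

Lemma grad_continuous (R : realType) (n m : nat) (F : 'rV[R]_n -> 'rV[R]_m)
    (i : 'I_m) (j : 'I_n) : continuously_differentiable F ->
  continuous (fun z => grad F i z 0 j).
Proof.
move=> [_ Jc] z.
have -> : (fun z => grad F i z 0 j) = (fun z => jacobian F z j i).
  by apply/funext => y; rewrite !mxE.
apply: (@continuous_comp _ _ _ (jacobian F) (fun M => M j i)); first exact: Jc.
exact: coord_continuous.
Qed.

Lemma mean_value (R : realType) (n m : nat) (F : 'rV[R]_n -> 'rV[R]_m)
    (i : 'I_m) (x d : 'rV[R]_n) : continuously_differentiable F ->
  exists2 t : R, 0 <= t <= 1 &
    F (x + d) 0 i - F x 0 i = dotr d (grad F i (x + t *: d)).
Proof.
move=> [Fd _]; pose f (t : R) : R := F (x + t *: d) 0 i.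
have fd (t : R) : is_derive t (1 : R) f (dotr d (grad F i (x + t *: d))).
  have dF : derivable F (x + t *: d) d by exact: diff_derivable.
  have dFi : is_derive (x + t *: d) d (fun z => F z 0 i)
      (dotr d (grad F i (x + t *: d))).
    apply: DeriveDef; first exact: ((derivable_mxP _ _ _).1 dF).
    rewrite -Japply_dotr /Japply -deriveEjacobian // derive_mx //.
    by rewrite mxE.
  (* The difference quotients of [f] at [t] are those of the component of [F] at [x + t *: d] along
     [d], so the directional derivative transfers directly. *)
  have E : (fun h : R => h^-1 *: (f (h *: 1 + t) - f t))
      = (fun h : R => h^-1 *: (F (h *: d + (x + t *: d)) 0 i - F (x + t *: d) 0 i)).
    apply/funext => h; rewrite /f; congr (_ *: (F _ 0 i - _)).
    by rewrite scalerDl [h *: 1]mulr1 addrCA.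
  apply: DeriveDef.
    by rewrite /derivable E; exact: ex_derive.
  by rewrite /derive E -[RHS](@derive_val _ _ _ _ _ _ _ dFi).
have fcont : {within `[0, 1], continuous f}.
  by apply: derivable_within_continuous => t _; exact: ex_derive.
have [t t01] := MVT_segment ler01 (fun t _ => fd t) fcont.
rewrite subr0 mulr1 /f scale1r scale0r addr0 => ft.
by exists t => //; move: t01; rewrite in_itv.
Qed.

Lemma grad_dotr_bounded (R : realType) (n m : nat) (F : 'rV[R]_n -> 'rV[R]_m)
    (i : 'I_m) (r : R) : continuously_differentiable F ->
  exists2 G, 0 <= G &
    forall z, `|z| <= r -> dotr (grad F i z) (grad F i z) <= G.
Proof.
move=> FC; apply: compact_bounded_above.
by apply: continuous_dotr => j; exact: grad_continuous.
Qed.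

Lemma component_continuous (R : realType) (n m : nat)
    (F : 'rV[R]_n -> 'rV[R]_m) (i : 'I_m) : continuously_differentiable F ->
  continuous (fun z => F z 0 i).
Proof.
move=> [Fd _] z; apply: (@continuous_comp _ _ _ F (fun v => v 0 i)).
  exact: differentiable_continuous.
exact: coord_continuous.
Qed.

Lemma norm_segment_le (R : realType) (n : nat) (x d : 'rV[R]_n) (t r : R) :
  0 <= t <= 1 -> `|x| <= r -> `|x + d| <= r -> `|x + t *: d| <= r.
Proof.
move=> /andP[t0 t1] xr yr.
have -> : x + t *: d = (1 - t) *: x + t *: (x + d).
  by rewrite scalerDr addrA -scalerDl subrK scale1r.
apply: le_trans (ler_normD _ _) _; rewrite !normrZ !ger0_norm ?subr_ge0 //.
by nra.
Qed.

Lemma variation_sq_le (R : realType) (n m : nat) (F : 'rV[R]_n -> 'rV[R]_m)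
    (i : 'I_m) (r G : R) (x d : 'rV[R]_n) : continuously_differentiable F ->
  (forall z, `|z| <= r -> dotr (grad F i z) (grad F i z) <= G) ->
  `|x| <= r -> `|x + d| <= r ->
  (F (x + d) 0 i - F x 0 i) ^+ 2 <= G * dotr d d.
Proof.
move=> FC Gb xr yr; have [t t01 ->] := mean_value i x d FC.
apply: le_trans (dotr_cauchy_schwarz _ _) _.
by rewrite mulrC ler_wpM2r ?dotr_ge0 // Gb // norm_segment_le.
Qed.

(** * Descent properties of the search directions *)

Lemma simplex_inhabited (R : realType) (m : nat) (lam : 'rV[R]_m) :
  simplex R m lam -> inhabited 'I_m.
Proof.
case: m lam => [|m] lam [lam1 _]; last by split; exact: ord0.
by move: lam1; rewrite big_ord0 => /eqP; rewrite eq_sym oner_eq0.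
Qed.

(** [argmin_simplex_dotr] for the scaled family bounds the squared norm of the combination by its
    product with [g i] divided by [a i]; multiply by [a i >= a0]. *)
Lemma scaled_argmin_descent (R : realType) (n m : nat) (g : 'I_m -> 'rV[R]_n)
    (a : 'I_m -> R) (a0 : R) (lam : 'rV[R]_m) (i : 'I_m) :
  0 < a0 -> a0 <= a i -> argmin_simplex (fun i => (a i)^-1 *: g i) lam ->
  let d := - lincomb (fun i => (a i)^-1 *: g i) lam in
  dotr d (g i) <= - (a0 * dotr d d).
Proof.
move=> a00 ai /(argmin_simplex_dotr i) /=.
set w := lincomb _ _ => h; rewrite !dotrE opprK (dotrC w) lerN2.
have ai0 : 0 < a i by lra.
apply: le_trans (ler_wpM2r (dotr_ge0 w) ai) _.
by move: h; rewrite dotrZl mulrC ler_pdivlMr // mulrC.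
Qed.

(** The direction is a convex combination of vectors [- (a i)^-1 *: g i], each having product at
    least [e / a1] with [v]. *)
Lemma scaled_direction_dotr_ge (R : realType) (n m : nat)
    (g : 'I_m -> 'rV[R]_n) (a : 'I_m -> R) (a1 e : R) (lam : 'rV[R]_m)
    (v : 'rV[R]_n) : 0 <= e -> (forall i, 0 < a i <= a1) ->
  simplex R m lam -> (forall i, dotr (g i) v <= - e) ->
  e / a1 <= dotr (- lincomb (fun i => (a i)^-1 *: g i) lam) v.
Proof.
move=> e0 aP [lam1 lam0] gv.
rewrite dotrNl dotr_suml -sumrN.
rewrite -[leLHS]mul1r -lam1 mulr_suml; apply: ler_sum => i _.
have /andP[ai0 ai1] := aP i.
rewrite !dotrZl -mulrN ler_wpM2l // -mulrN mulrC.
apply: ler_pM => //; first by rewrite invr_ge0; lra.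
  by rewrite lef_pV2 // posrE; lra.
by have := gv i; lra.
Qed.

Lemma dotr_lower_bound (R : realType) (n : nat) (d v : 'rV[R]_n) (h : R) :
  0 <= h -> h <= dotr d v -> h ^+ 2 / (dotr v v + 1) <= dotr d d.
Proof.
move=> h0 hd; have v0 := dotr_ge0 v; have d0 := dotr_ge0 d.
rewrite ler_pdivrMr; last by lra.
have := dotr_cauchy_schwarz d v; nra.
Qed.

(** * Consequences of the stepsize rule *)

Lemma stepsize_bounds (R : realType) (n m : nat) (F : 'rV[R]_n -> 'rV[R]_m)
    (sigma gamma : R) (x d : 'rV[R]_n) (C : 'rV[R]_m) (beta : R) :
  0 < gamma < 1 -> is_stepsize F sigma gamma x d C beta -> 0 < beta <= 1.
Proof.
move=> /andP[g0 g1] [[[l ->] _] _].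
by rewrite exprn_gt0 //= exprn_ile1 ?ltW.
Qed.

Lemma stepsize_decrease (R : realType) (n m : nat) (F : 'rV[R]_n -> 'rV[R]_m)
    (sigma gamma : R) (x d : 'rV[R]_n) (C : 'rV[R]_m) (beta : R) (i : 'I_m) :
  is_stepsize F sigma gamma x d C beta ->
  F (x + beta *: d) 0 i <= C 0 i + sigma * beta * dotr d (grad F i x).
Proof.
move=> [[_ /(_ i) h] _]; move: h.
by rewrite [X in _ <= X -> _]mxE Japply_dotr mxE [X in _ + X <= _ -> _]mxE lerBlDl.
Qed.

(** As [beta < 1] is a positive power of [gamma], [beta / gamma] is a larger candidate and fails the
    test for [C] in some component; it then also fails with [F x] in place of [C], as [F x] lies
    below [C]. *)
Lemma stepsize_rejected (R : realType) (n m : nat) (F : 'rV[R]_n -> 'rV[R]_m)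
    (sigma gamma : R) (x d : 'rV[R]_n) (C : 'rV[R]_m) (beta : R) :
  0 < gamma < 1 -> is_stepsize F sigma gamma x d C beta -> beta < 1 ->
  vle (F x) C ->
  exists i, sigma * (beta / gamma) * dotr d (grad F i x)
            < F (x + (beta / gamma) *: d) 0 i - F x 0 i.
Proof.
move=> /andP[g0 g1] [[[[|l] ->] _] bmax] b1 FC; first by rewrite expr0 ltxx in b1.
have E : gamma ^+ l.+1 / gamma = gamma ^+ l by rewrite exprSr mulfK ?gt_eqF.
rewrite E; apply: contrapT => /forallNP nF.
suff /bmax : (exists l', gamma ^+ l = gamma ^+ l') /\
    sufficient_decrease F sigma x d C (gamma ^+ l).
  by rewrite exprS leNgt gtr_pMl ?g1 // exprn_gt0.
split; first by exists l.
move=> i; rewrite [X in _ <= X]mxE Japply_dotr mxE [X in _ + X]mxE.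
have /negP := nF i; rewrite -leNgt; apply: le_trans.
by rewrite lerB // FC.
Qed.

(** By the mean value theorem the slope along [d] at an intermediate point exceeds [sigma] times the
    slope at [x]; so [dotr d h] exceeds [(1 - sigma) * c * dotr d d], and Cauchy-Schwarz applies. *)
Lemma rejected_grad_gap (R : realType) (n m : nat) (F : 'rV[R]_n -> 'rV[R]_m)
    (i : 'I_m) (sigma b c : R) (x d : 'rV[R]_n) :
  continuously_differentiable F -> sigma < 1 -> 0 < b -> 0 < c ->
  0 < dotr d d -> dotr d (grad F i x) <= - (c * dotr d d) ->
  sigma * b * dotr d (grad F i x) < F (x + b *: d) 0 i - F x 0 i ->
  exists2 t : R, 0 <= t <= 1 &
    let h := grad F i (x + t *: (b *: d)) - grad F i x in
    ((1 - sigma) * c) ^+ 2 * dotr d d < dotr h h.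
Proof.
move=> FC s1 b0 c0 dd dg; have [t t01 ->] := mean_value i x (b *: d) FC.
move=> H; exists t => //=; move: H.
move: (grad F i (x + _)) => g; set h := g - _.
have -> : g = h + grad F i x by rewrite subrK.
rewrite dotrZl dotrDr -mulrA mulrCA ltr_pM2l // => H.
have CS := dotr_cauchy_schwarz d h.
have lb : (1 - sigma) * c * dotr d d < dotr d h by nra.
have lb0 : 0 < (1 - sigma) * c * dotr d d by rewrite !mulr_gt0 ?subr_gt0.
rewrite -(ltr_pM2l dd); apply: lt_le_trans CS.
by nra.
Qed.

(** * Reference values of the line searches *)

Lemma line_search_ref_component (R : realType) (n m : nat)
    (F : 'rV[R]_n -> 'rV[R]_m) (x : nat -> 'rV[R]_n) (C : nat -> 'rV[R]_m)
    (i : 'I_m) : line_search_ref F x C ->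
  let f k := F (x k) 0 i in
  (exists M, forall k, C k 0 i = window_max M f k) \/
  (exists2 eta : R, 0 < eta < 1 & forall k, C k 0 i = running_avg eta f k).
Proof.
move=> hC f; case: hC => [->|[M ->]|[eta [eta01 ->]]].
- left; exists 0%N => k; rewrite /armijo_ref; apply/eqP; rewrite eq_le.
  rewrite (window_max_cur 0 f k) /=.
  by apply: window_max_le => j _; rewrite leqn0 => /eqP ->; rewrite subn0.
- by left; exists M => k; rewrite mxE.
- right; exists eta => // k; elim: k => //= k <-.
  by rewrite !mxE.
Qed.

(** Lets the initial Armijo step be treated as a step of the chosen line search. *)
Lemma line_search_ref0 (R : realType) (n m : nat)
    (F : 'rV[R]_n -> 'rV[R]_m) (x : nat -> 'rV[R]_n) (C : nat -> 'rV[R]_m) :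
  line_search_ref F x C -> C 0%N = F (x 0%N).
Proof.
move=> hC; apply/rowP => i.
have [[M ->]|[eta _ ->]] := line_search_ref_component i hC => //.
apply/eqP; rewrite eq_le window_max_cur andbT.
by apply: window_max_le => j; rewrite leqn0 => /eqP ->.
Qed.

Lemma line_search_ref_monotone (R : realType) (n m : nat)
    (F : 'rV[R]_n -> 'rV[R]_m) (x : nat -> 'rV[R]_n) (C : nat -> 'rV[R]_m) :
  line_search_ref F x C -> (forall k, vle (F (x k.+1)) (C k)) ->
  forall k, vle (F (x k)) (C k) /\ vle (C k) (F (x 0%N)).
Proof.
move=> hC dec.
have curr k : vle (F (x k)) (C k).
  move=> i; have [[M CE]|[eta /andP[eta0 _] CE]] := line_search_ref_component i hC.
    by rewrite CE; exact: (window_max_cur M (fun k => F (x k) 0 i)).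
  rewrite CE; apply: (running_avg_cur (f := fun k => F (x k) 0 i)) => // j.
  by rewrite -CE; exact: dec.
move=> k; split=> // i; elim: k => [|k IH]; first by rewrite (line_search_ref0 hC).
apply: le_trans IH; have := dec k i.
have [[M CE]|[eta /andP[eta0 _] CE]] := line_search_ref_component i hC.
  by rewrite !CE; exact: (window_max_noninc (f := fun k => F (x k) 0 i)).
by rewrite !CE; exact: (running_avg_noninc (f := fun k => F (x k) 0 i)).
Qed.

Lemma line_search_step_to0 (R : realType) (n m : nat)
    (F : 'rV[R]_n -> 'rV[R]_m) (x : nat -> 'rV[R]_n) (C : nat -> 'rV[R]_m)
    (i : 'I_m) (delta : nat -> R) (b c K : R) :
  line_search_ref F x C -> 0 < c -> 0 <= K ->
  (forall k, b <= F (x k) 0 i) ->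
  (forall k, 0 <= delta k) ->
  (forall k, F (x k.+1) 0 i <= C k 0 i - c * delta k) ->
  (forall k, (F (x k.+1) 0 i - F (x k) 0 i) ^+ 2 <= K * delta k) ->
  forall e, 0 < e -> \forall k \near \oo, delta k < e.
Proof.
move=> hC c0 K0 fb d0 fdec fvar.
pose f k := F (x k) 0 i.
have [[M CE]|[eta eta01 CE]] := line_search_ref_component i hC.
  have fdec' k : f k.+1 <= window_max M f k - c * delta k.
    by rewrite -CE; exact: fdec.
  exact: (window_max_step_to0 c0 K0 fb d0 fdec' fvar).
have fdec' k : f k.+1 <= running_avg eta f k - c * delta k.
  by rewrite -CE; exact: fdec.
exact: (running_avg_step_to0 eta01 c0 fb d0 fdec').
Qed.

(** * Gradients near a point; vanishing steps *)

Lemma pareto_noncritical_near (R : realType) (n m : nat)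
    (F : 'rV[R]_n -> 'rV[R]_m) (p v : 'rV[R]_n) :
  continuously_differentiable F -> (forall i, Japply F p v 0 i < 0) ->
  exists2 e : R, 0 < e &
    \forall z \near p, forall i, dotr (grad F i z) v <= - e.
Proof.
move=> FC Jneg.
have [e e0 He] : exists2 e : R, 0 < e &
    forall i, dotr (grad F i p) v < - e.
  (* Finitely many strict inequalities share a margin: any small enough positive [e]. *)
  near (0 : R)^'+ => e; exists e => // i; rewrite dotrC -Japply_dotr ltrNr.
  move: i; near: e; apply: filter_forall => i.
  by apply: nbhs_right_lt; rewrite oppr_gt0.
exists e => //.
apply: (@filter_forall _ _ (fun i z => dotr (grad F i z) v <= - e) (nbhs p) _) => i.
have gc : continuous (fun z => dotr (grad F i z) v).
  apply: (@continuous_dotr _ _ _ _ (fun=> v)) => j; last exact: cst_continuous.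
  exact: grad_continuous.
near=> z; apply: ltW.
near: z; apply: (cvgr_lt (dotr (grad F i p) v)) => //.
exact: gc.
Unshelve. all: by end_near. Qed.

Lemma grad_near (R : realType) (n m : nat) (F : 'rV[R]_n -> 'rV[R]_m)
    (p : 'rV[R]_n) (e : R) : continuously_differentiable F -> 0 < e ->
  \forall z \near p, forall i : 'I_m,
    dotr (grad F i z - grad F i p) (grad F i z - grad F i p) < e.
Proof.
move=> FC e0.
apply: (@filter_forall _ _ (fun (i : 'I_m) z =>
  dotr (grad F i z - grad F i p) (grad F i z - grad F i p) < e) (nbhs p) _) => i.
pose h z := grad F i z - grad F i p.
have hc j : continuous (fun z => h z 0 j).
  have -> : (fun z => h z 0 j)
      = (fun z => grad F i z 0 j) - cst (grad F i p 0 j).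
    by apply/funext => z; rewrite [LHS]mxE [X in _ + X]mxE.
  have gc : continuous (fun z => grad F i z 0 j) by exact: grad_continuous.
  by move=> z; apply: (cvgB (gc z)); exact: cvg_cst.
apply: (cvgr_lt (dotr (h p) (h p))).
  exact: (continuous_dotr hc hc).
rewrite /h subrr /dotr big1 // => j _.
by rewrite mxE mul0r.
Qed.

(* All reference values stay below F (x 0), so the iterates stay in the bounded
   level set; a gradient bound on a ball containing it controls the variation
   of F along a step. *)
Lemma bbdmo_step_to0 (R : realType) (n m : nat) (F : 'rV[R]_n -> 'rV[R]_m)
    (sigma gamma c : R) (x d : nat -> 'rV[R]_n) (C : nat -> 'rV[R]_m)
    (beta : nat -> R) (i0 : 'I_m) :
  0 < sigma -> 0 < gamma < 1 -> 0 < c -> continuously_differentiable F ->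
  bounded_set [set z | vle (F z) (F (x 0%N))] ->
  line_search_ref F x C ->
  (forall k, is_stepsize F sigma gamma (x k) (d k) (C k) (beta k)) ->
  (forall k i, dotr (d k) (grad F i (x k)) <= - (c * dotr (d k) (d k))) ->
  (forall k, x k.+1 = x k + beta k *: d k) ->
  (forall k, vle (F (x k)) (C k)) /\
  forall e, 0 < e -> \forall k \near \oo, beta k * dotr (d k) (d k) < e.
Proof.
move=> s0 g01 c0 FC bnd hC st desc xS.
have b01 k : 0 < beta k <= 1 by exact: stepsize_bounds (st k).
pose delta k := beta k * dotr (d k) (d k).
have delta0 k : 0 <= delta k.
  by rewrite mulr_ge0 ?dotr_ge0 //; case/andP: (b01 k) => /ltW.
have dec k i : F (x k.+1) 0 i <= C k 0 i - sigma * c * delta k.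
  have := stepsize_decrease i (st k); rewrite -xS => /le_trans; apply.
  have /andP[b0 _] := b01 k.
  have h : beta k * dotr (d k) (grad F i (x k)) <= - (c * delta k).
    by rewrite /delta mulrCA -mulrN ler_pM2l.
  by have := ler_wpM2l (ltW s0) h; lra.
have mono : forall k, vle (F (x k)) (C k) /\ vle (C k) (F (x 0%N)).
  apply: line_search_ref_monotone => // k i; apply: le_trans (dec k i) _.
  by rewrite gerBl (mulr_ge0 (mulr_ge0 (ltW s0) (ltW c0)) (delta0 k)).
split=> [k|]; first by case: (mono k).
have [r xr] : exists r, forall k, `|x k| <= r.
  have [r [_ rP]] := bnd; exists (r + 1) => k.
  apply: (rP (r + 1)); first by rewrite ltrDl.
  by move=> i; case: (mono k) => h1 h2; exact: le_trans (h1 i) (h2 i).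
have [G G0 Gb] := grad_dotr_bounded i0 r FC.
have [B _ Bb] : exists2 B, 0 <= B & forall z : 'rV_n, `|z| <= r -> - F z 0 i0 <= B.
  apply: compact_bounded_above => z; have Fc := @component_continuous _ _ _ F i0 FC.
  by apply: (cvgN (Fc z)).
apply: (@line_search_step_to0 _ _ _ F x C i0 delta (- B) (sigma * c) G) => //.
- by rewrite mulr_gt0.
- by move=> k; rewrite lerNl Bb.
move=> k; rewrite xS.
apply: le_trans (variation_sq_le FC Gb _ _) _ => //.
  by rewrite -xS.
rewrite dotrZl dotrZr ler_wpM2l //.
(* Since [beta k <= 1], the squared step length is at most [delta k]. *)
have /andP[b0 b1] := b01 k.
by rewrite ler_pM2l // ler_piMl ?dotr_ge0.
Qed.

(** * Accumulation points of the run *)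

Set Strict Implicit.
Unset Implicit Arguments.

Theorem theorem1 (R : realType) (n m : nat) (F : 'rV[R]_n -> 'rV[R]_m)
    (sigma gamma amin amax : R) (x0 : 'rV[R]_n)
    (x : nat -> 'rV[R]_n) (C : nat -> 'rV[R]_m)
    (hsigma : 0 < sigma < 1) (hgamma : 0 < gamma < 1)
    (hamin : 0 < amin) (hamax : amin <= amax)
    (hF : continuously_differentiable F)
    (hbounded : bounded_set [set z | vle (F z) (F x0)])
    (hx0 : x 0%N = x0)
    (hC : line_search_ref F x C)
    (hrun : bbdmo_run F sigma gamma amin amax C x)
    (hnoncrit : forall k : nat, ~ pareto_critical F (x k)) :
  forall p : 'rV[R]_n, cluster (x @ \oo) p -> pareto_critical F p.
Proof.
move=> p clp; rewrite /pareto_critical -subset0 => w [[v _ <-] /= Jneg].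
case: hrun => lam [d [beta [am0 d0E st0 stk xS]]].
have [i0] : inhabited 'I_m by apply: (@simplex_inhabited _ _ (lam 0%N)); case: am0.
(* The scaling is 1 at [k = 0] and at least [amin] afterwards. *)
pose c := Num.min 1 amin.
have c0 : 0 < c by rewrite lt_min ltr01.
have st k : is_stepsize F sigma gamma (x k) (d k) (C k) (beta k).
  case: k => [|k]; first by rewrite (line_search_ref0 hC).
  by have [] := stk k.+1 isT.
have desc k i : dotr (d k) (grad F i (x k)) <= - (c * dotr (d k) (d k)).
  case: k => [|k].
    rewrite d0E; move: am0.
    have -> : (fun i => grad F i (x 0%N)) = (fun i => 1^-1 *: grad F i (x 0%N)).
      by apply/funext => j; rewrite invr1 scale1r.
    move=> am0.
    apply: (@scaled_argmin_descent _ _ _ (fun i => grad F i (x 0%N)) (fun=> 1)) => //.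
    by rewrite /c ge_min lexx.
  have [am dE _ _] := stk k.+1 isT; rewrite dE.
  apply: (scaled_argmin_descent (g := fun i => grad F i (x k.+1)) _ _ am) => //.
  by rewrite (le_trans _ (bb_alpha_ge _ _ _ _)) // /c ge_min lexx orbT.
have [s0 s1] := andP hsigma; have [g0 g1] := andP hgamma.
rewrite -hx0 in hbounded.
have [curr step0] :=
  bbdmo_step_to0 i0 s0 hgamma c0 hF hbounded hC st desc xS.
have [e e0 gradv] := pareto_noncritical_near hF Jneg.
(* Lower bound for [dotr (d k) (d k)] when [x k] is near [p], from [dotr_lower_bound] with
   [h = e / amax]. *)
pose D := (e / amax) ^+ 2 / (dotr v v + 1).
have amax0 : 0 < amax by lra.
have D0 : 0 < D.
  by rewrite divr_gt0 ?exprn_gt0 ?divr_gt0 // ltr_wpDl ?dotr_ge0.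
(* Two gradients within squared distance [eta] of the one at [p] are within [4 * eta] of each other,
   which is the lower bound that [rejected_grad_gap] yields. *)
pose eta := ((1 - sigma) * c) ^+ 2 * D / 4.
have eta0 : 0 < eta.
  by rewrite divr_gt0 // mulr_gt0 // exprn_gt0 // mulr_gt0 // subr_gt0.
have [r /= r0 rP] := (nbhs_ballP _ _).1 (filterI gradv (grad_near p hF eta0)).
rewrite -ball_normE in rP.
have r20 : 0 < r / 2 by rewrite divr_gt0.
(* The bound [D] forces [beta k < 1]; the other one keeps the rejected trial within [r / 2] of
   [x k]. *)
have [N _ small] : \forall k \near \oo,
    beta k * dotr (d k) (d k) < Num.min D ((gamma * (r / 2)) ^+ 2).
  by apply: step0; rewrite lt_min D0 exprn_gt0 ?mulr_gt0.
(* [N.+1] rather than [N] ensures [k > 0], where the scaled direction is in force. *)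
have [k Nk xk] : exists2 k, (N.+1 <= k)%N & ball p (r / 2) (x k).
  have /clp : (x @ \oo) (x @` [set k | (N.+1 <= k)%N]).
    by exists N.+1 => // k /= Nk; exists k.
  by move=> /(_ _ (nbhsx_ballx p _ r20)) [_ [[k Nk <-] xk]]; exists k.
rewrite -ball_normE /ball_ /= in xk.
have := small k (ltnW Nk); rewrite /= lt_min => /andP[smallD smallr].
have k0 : (0 < k)%N by apply: leq_trans Nk.
have pxk : `|p - x k| < r by lra.
have [gv gx] := rP _ pxk.
have Dd : D <= dotr (d k) (d k).
  apply: dotr_lower_bound; first by rewrite divr_ge0 ?ltW.
  have [[lamS _] -> _ _] := stk k k0.
  apply: (scaled_direction_dotr_ge (g := fun i => grad F i (x k)) _ _ lamS gv).
    exact: ltW.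
  by move=> i; rewrite bb_alpha_le // andbT (lt_le_trans hamin) ?bb_alpha_ge.
have dd0 : 0 < dotr (d k) (d k) by lra.
have /andP[b0 b1] := stepsize_bounds hgamma (st k).
have bk1 : beta k < 1.
  by rewrite -(ltr_pM2r dd0) mul1r (lt_le_trans smallD).
have [i rej] := stepsize_rejected hgamma (st k) bk1 (curr k).
have bg0 : 0 < beta k / gamma by rewrite divr_gt0.
have [t /andP[t0 t1] gap] :=
  rejected_grad_gap hF s1 bg0 c0 dd0 (desc k i) rej.
have trial_norm : `|(beta k / gamma) *: d k| < r / 2.
  apply: norm_lt_of_dotr => //; rewrite dotrZl dotrZr -(ltr_pM2l (exprn_gt0 2 g0)).
  rewrite -[ltRHS]exprMn; apply: le_lt_trans smallr.
  have -> : gamma ^+ 2 * (beta k / gamma * (beta k / gamma * dotr (d k) (d k)))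
      = beta k * (beta k * dotr (d k) (d k)) by field; rewrite gt_eqF.
  by rewrite ler_pM2l // ler_piMl ?dotr_ge0.
have pxi : `|p - (x k + t *: ((beta k / gamma) *: d k))| < r.
  rewrite opprD addrA; apply: le_lt_trans (ler_normB _ _) _.
  rewrite [r]splitr; apply: ltrD => //.
  apply: le_lt_trans trial_norm.
  by rewrite normrZ ger0_norm // ler_piMl.
have [_ gxi] := rP _ pxi.
have sum_lt (q1 q2 q : R) : q1 < eta -> q2 < eta -> q <= 2 * q1 + 2 * q2 ->
    q < 4 * eta by lra.
have := lt_trans gap (sum_lt _ _ _ (gxi i) (gx i) (dotr_sub_le _ _ _)).
have -> : 4 * eta = ((1 - sigma) * c) ^+ 2 * D by rewrite /eta; field.
rewrite ltr_pM2l; first by rewrite ltNge Dd.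
by rewrite exprn_gt0 // mulr_gt0 // subr_gt0.
Qed.
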